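(* Let $M\in\mathbb{N}$, $M\ge2$, let $\rho$ be as described in the context, and suppose that $r\in C([0,1])\cap C^\infty((0,1])$ solves the boundary value problem $$\frac{M^2r}{R}=\dot r+R\ddot r+M\rho''(d)\,\dot d\,r\quad\text{in }(0,1),\qquad r(0)=0,\quad r(1)=1,$$ where $d(R)=\frac{M\,r(R)\,\dot r(R)}{R}$. Then $d(0)=0$, where $d(0):=\lim_{R\to0}d(R)$. Moreover, one of the following two situations occurs: (i) $r$ is lifting-off delayed, i.e. there exists $0<\delta<1$ such that $r\equiv0$ on $[0,\delta]$. Then $r\in C^\infty([0,1])$. (ii) $r$ is lifting-off immediately, i.e. $r>0$ and $\dot r>0$ on $(0,1]$. Then $r\in C^1([0,1])$ and $\dot r(0)=0$.
   Context: Dots denote derivatives with respect to $R$. The function $\rho\in C^\infty(\mathbb{R})$ is given by $\rho(s)=0$ for $s\le 0$, $\rho(s)=\rho_1(s)$ for $0\le s\le s_0$, and $\rho(s)=\gamma s+\kappa$ for $s\ge s_0$, where $0<\gamma<\infty$, $s_0\ge0$, $\kappa\ge-\gamma s_0$ are constants and $\rho_1:[0,s_0]\to\mathbb{R}$ is smooth and convex with $\rho_1(0)=0$, $\rho_1(s_0)=\gamma s_0+\kappa$, the pieces being connected so that $\rho$ is smooth on $\mathbb{R}$; $\rho$ is convex on $\mathbb{R}$. The boundary value problem is the reduction, for radially symmetric $M$-covering maps $u(x)=r(R)(\cos M\theta,\sin M\theta)$ on the unit disc in polar coordinates $(R,\theta)$ (for which $d=\det\nabla u$), of the Euler–Lagrange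 equation of $\int\frac12|\nabla u|^2+\rho(\det\nabla u)\,dx$. *)

(* Defs.v *)
From Stdlib Require Import Reals.
From Coquelicot Require Import Coquelicot.
Open Scope R_scope.

Definition Icc (a b x : R) : Prop := a <= x <= b.
Definition Ioc (a b x : R) : Prop := a < x <= b.

Definition convex_on (D : R -> Prop) (f : R -> R) : Prop :=
  forall x y t : R, D x -> D y -> 0 <= t <= 1 ->
    f (t * x + (1 - t) * y) <= t * f x + (1 - t) * f y.

(* On an interval [D], [D_in f f' D x] is the derivative along points of [D]:
   two-sided in the interior, one-sided at an endpoint belonging to [D].
   The values of [f] outside [D] are irrelevant. *)
Definition C1_on (D : R -> Prop) (f : R -> R) : Prop :=
  exists f' : R -> R,
    (forall x : R, D x -> D_in f f' D x) /\ continuous_on D f'.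

(* [F k] is the k-th derivative of [f] on [D]. Its continuity on [D] follows
   from its differentiability. *)
Definition smooth_on (D : R -> Prop) (f : R -> R) : Prop :=
  exists F : nat -> R -> R,
    (forall x : R, D x -> F 0%nat x = f x) /\
    (forall (k : nat) (x : R), D x -> D_in (F k) (F (S k)) D x).

Record admissible_rho (gamma s0 kappa : R) (rho1 rho : R -> R) : Prop := {
  gamma_pos : 0 < gamma;
  s0_nonneg : 0 <= s0;
  kappa_ge : - gamma * s0 <= kappa;
  rho1_smooth : smooth_on (Icc 0 s0) rho1;
  rho1_convex : convex_on (Icc 0 s0) rho1;
  rho1_at_0 : rho1 0 = 0;
  rho1_at_s0 : rho1 s0 = gamma * s0 + kappa;
  rho_nonpos : forall s : R, s <= 0 -> rho s = 0;
  rho_middle : forall s : R, 0 <= s <= s0 -> rho s = rho1 s;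
  rho_affine : forall s : R, s0 <= s -> rho s = gamma * s + kappa;
  rho_smooth : forall (n : nat) (s : R), ex_derive_n rho n s;
  rho_convex : convex_on (fun _ => True) rho
}.

(* [Derive] is the two-sided derivative, so this is meaningful on the open
   interval (0, 1) only. *)
Definition jac (M : nat) (r : R -> R) (x : R) : R :=
  INR M * r x * Derive r x / x.

Record solves_bvp (M : nat) (rho r : R -> R) : Prop := {
  bvp_ode : forall x : R, 0 < x < 1 ->
    INR M ^ 2 * r x / x =
      Derive r x + x * Derive_n r 2 x
      + INR M * Derive_n rho 2 (jac M r x) * Derive (jac M r) x * r x;
  bvp_0 : r 0 = 0;
  bvp_1 : r 1 = 1
}.

Definition lifting_off_delayed (r : R -> R) : Prop :=
  exists delta : R, 0 < delta < 1 /\ forall x : R, 0 <= x <= delta -> r x = 0.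

Definition lifting_off_immediately (r : R -> R) : Prop :=
  forall x : R, Ioc 0 1 x ->
    0 < r x /\ exists l : R, D_in r (fun _ => l) (Ioc 0 1) x /\ 0 < l.

(* Main.v *)
Require Import Defs.
From Stdlib Require Import Reals Lra Classical.
From Coquelicot Require Import Coquelicot.
Open Scope R_scope.

(** Write v and a for the first two derivatives of r, sigma = rho'' (which is
    nonnegative by convexity), and d = m r v / x with m = M.

    Dichotomy.  At a critical point of r every term of the equation coming from
    the derivative of d reduces to a multiple of a, and the equation reads
    a (x + m^2 sigma(d) r^2 / x) = m^2 r / x.  So a has the sign of r there: r has
    no positive interior maximum and, by the symmetry r -> -r, no negative interior
    minimum ([weak_maximum_principle]).  With r 0 = 0 and r 1 = 1 this gives
    r >= 0.  If r vanishes at some b in (0,1), then it vanishes on [0,b]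
    ([delayed_or_positive]); otherwise r is positive, nondecreasing and without
    critical points, so v > 0 on (0,1) ([velocity_positive]).

    Delayed case.  All derivatives of r vanish near 0, so they extend by 0 to
    smooth derivatives on [0,1] ([delayed_smooth]), and d vanishes near 0.

    Increasing case.  In terms of the logarithmic slope q = x v / r the equation
    is of Riccati type ([riccati]),
      x q' (q + w) = q (m^2 - q^2 - 2 w (q - 1)),   w = m sigma(d) d.
    Since rho is affine beyond s0, sigma vanishes there, so 0 <= w <= C
    ([second_derivative_bound]).  The right-hand side is positive for q slightly
    above 1 and below, since m >= 2, and negative for large q.  Following the
    equation from a point towards 0 therefore has two consequences.
    If q < 1 + e at one point, for a suitable e > 0 depending on C only, then
    q stays below 1 + e and q' >= k q / x = k (ln r)'.  Hence ln r would be
    bounded below, contradicting r(0) = 0 ([log_slope_lower]).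
    If q > 2 m at one point, then q stays above 2 m and (1/q)' >= k / x, so that
    1/q would reach 0 at a positive radius ([log_slope_upper]).
    Thus 1 + e <= q <= 2 m on (0,1).  Integrating the lower bound gives
    r <= x^(1+e) ([power_growth]), and the upper bound then gives v <= 2 m x^e
    ([velocity_growth]).  Everything claimed at 0 follows: r/x, v and
    d = m (r/x) v tend to 0.  At x = 1, r <= x forces the one-sided derivative
    to be at least 1 ([increasing_lift_off]). *)

(** * Real-variable tools *)

Lemma nondecreasing_of_derive (f f' : R -> R) (x y : R) :
  x <= y ->
  (forall t, x <= t <= y -> is_derive f t (f' t)) ->
  (forall t, x < t < y -> 0 <= f' t) ->
  f x <= f y.
Proof.
  intros Hxy Hd Hpos.
  destruct (Rle_lt_or_eq_dec x y Hxy) as [Hlt | ->]; [| lra].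
  destruct (MVT_cor2 f f' x y Hlt) as [c [Hc Hin]].
  { intros t Ht; apply is_derive_Reals, Hd, Ht. }
  specialize (Hpos c Hin). nra.
Qed.

(** If [f] reached the level [A] to the left of [x1], then from the last point where
    it does so it would be nondecreasing up to [x1], hence at least [A] there. *)
Lemma barrier_below (f f' : R -> R) (A x1 : R) :
  (forall x, 0 < x <= x1 -> is_derive f x (f' x)) ->
  (forall x, 0 < x <= x1 -> f x < A -> 0 <= f' x) ->
  f x1 < A ->
  forall x, 0 < x <= x1 -> f x < A.
Proof.
  intros Hd Hpos H1 x Hx.
  destruct (Rlt_le_dec (f x) A) as [|Hge]; [assumption|exfalso].
  set (E := fun t => x <= t <= x1 /\ A <= f t).
  destruct (completeness E) as [s [Hub Hlub]].
  { exists x1; intros t [Ht _]; lra. }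
  { exists x; split; [lra|assumption]. }
  assert (Hxs : x <= s) by (apply Hub; split; [lra|assumption]).
  assert (Hs1 : s <= x1) by (apply Hlub; intros t [Ht _]; lra).
  assert (Hfs : A <= f s).
  { apply Rnot_lt_le; intro Hlt.
    assert (Hc : continuity_pt f s).
    { apply derivable_continuous_pt. exists (f' s).
      apply is_derive_Reals, Hd; lra. }
    destruct (Hc (A - f s)) as [e [He Hn]]; [lra|].
    assert (s <= s - e); [|lra].
    apply Hlub; intros t [Ht HA].
    apply Rnot_lt_le; intro Hte.
    assert (t <= s) by (apply Hub; split; assumption).
    destruct (Req_dec t s) as [->|Hne]; [lra|].
    assert (Hb : Rabs (f t - f s) < A - f s).
    { apply Hn; split; [split; [exact I|congruence]|].
      simpl; unfold R_dist; apply Rabs_def1; lra. }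
    apply Rabs_def2 in Hb; lra. }
  assert (f s <= f x1); [|lra].
  apply nondecreasing_of_derive with f'; [lra| |].
  - intros t Ht; apply Hd; lra.
  - intros t Ht; apply Hpos; [lra|].
    apply Rnot_le_lt; intro HA.
    assert (t <= s) by (apply Hub; split; [lra|assumption]). lra.
Qed.

(** The second derivative test in the only form used below: a critical point with
    positive second derivative is not a maximum, and this is already visible on
    its left, so that it also applies at the right end of an interval. *)
Lemma left_neighbour_above (f f' : R -> R) (b c l : R) :
  b < c ->
  (forall t, b < t <= c -> is_derive f t (f' t)) ->
  f' c = 0 -> is_derive f' c l -> 0 < l ->
  exists y, b < y < c /\ f c < f y.
Proof.
  intros Hbc Hd H0 Hl Hpos.
  apply is_derive_Reals in Hl.
  destruct (Hl l Hpos) as [e He].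
  assert (Hneg : forall t, c - e < t < c -> f' t < 0).
  { intros t Ht.
    specialize (He (t - c)).
    replace (c + (t - c)) with t in He by ring.
    rewrite H0 in He.
    assert (Hb : Rabs ((f' t - 0) / (t - c) - l) < l).
    { apply He; [lra|apply Rabs_def1; lra]. }
    apply Rabs_def2 in Hb.
    assert (Hq : 0 < (f' t - 0) / (t - c)) by lra.
    replace (f' t) with ((f' t - 0) / (t - c) * (t - c)) by (field; lra).
    nra. }
  pose proof (cond_pos e).
  exists (Rmax ((b + c) / 2) (c - e / 2)).
  assert (Hy1 := Rmax_l ((b + c) / 2) (c - e / 2)).
  assert (Hy2 := Rmax_r ((b + c) / 2) (c - e / 2)).
  assert (Hy3 : Rmax ((b + c) / 2) (c - e / 2) < c) by (apply Rmax_lub_lt; lra).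
  set (y := Rmax _ _) in *.
  split; [lra|].
  destruct (MVT_cor2 f f' y c Hy3) as [d [Hmv Hin]].
  { intros t Ht; apply is_derive_Reals, Hd; lra. }
  specialize (Hneg d). nra.
Qed.

(** Continuity on [0,1] says nothing about the values outside, whereas the extreme
    value theorem asks for two-sided continuity; projecting onto [0,1] reconciles
    the two. *)
Lemma continuous_clamp (f : R -> R) :
  continuous_on (Icc 0 1) f ->
  forall x, continuity_pt (fun y => f (Rmax 0 (Rmin 1 y))) x.
Proof.
  intros Hf x.
  assert (HI : forall y, Icc 0 1 (Rmax 0 (Rmin 1 y))).
  { intro y; split; [apply Rmax_l|].
    apply Rmax_lub; [lra|apply Rmin_l]. }
  apply continuity_pt_filterlim.
  apply filterlim_comp with (2 := Hf _ (HI x)).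
  intros P HP.
  assert (Hc : filterlim (fun y => Rmax 0 (Rmin 1 y)) (locally x)
                 (locally (Rmax 0 (Rmin 1 x)))).
  { apply filterlim_locally; intros e; exists e; intros y Hy.
    unfold ball in *; simpl in *; unfold AbsRing_ball, abs, minus, plus, opp in *.
    simpl in *.
    unfold Rmax, Rmin; repeat destruct Rle_dec; revert Hy; split_Rabs; lra. }
  specialize (Hc _ HP). unfold filtermap in *.
  revert Hc; apply filter_imp; intros y Hy; apply Hy, HI.
Qed.

Lemma attains_max (f : R -> R) (b : R) :
  continuous_on (Icc 0 1) f -> 0 <= b <= 1 ->
  exists c, 0 <= c <= b /\ forall y, 0 <= y <= b -> f y <= f c.
Proof.
  intros Hf Hb.
  destruct (continuity_ab_maj (fun y => f (Rmax 0 (Rmin 1 y))) 0 b) as [c [Hc Hin]].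
  { lra. }
  { intros; apply continuous_clamp, Hf. }
  exists c; split; [exact Hin|].
  intros y Hy; specialize (Hc y Hy); simpl in Hc.
  rewrite !Rmin_right, !Rmax_right in Hc by lra. exact Hc.
Qed.

(** * The maximum principle and the dichotomy *)

(** [v], [a] and [sigma] stand for the derivatives of r and rho'', and the last
    summand of the equation is m sigma(d) d' r with d' written out in terms of r,
    v and a, so that algebraic manipulations apply to it directly. The value of r
    at 1 is left out because it breaks the symmetry r -> -r. *)
Record radial_solution (m : R) (sigma r v a : R -> R) : Prop := {
  rs_cont : continuous_on (Icc 0 1) r;
  rs_at_0 : r 0 = 0;
  rs_dr : forall x, 0 < x < 1 -> is_derive r x (v x);
  rs_dv : forall x, 0 < x < 1 -> is_derive v x (a x);
  rs_ode : forall x, 0 < x < 1 ->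
    m ^ 2 * r x / x =
      v x + x * a x
      + m * sigma (m * r x * v x / x)
        * (m * ((v x ^ 2 + r x * a x) / x - r x * v x / x ^ 2)) * r x
}.

(** The product r v, hence d, is even in r, so the equation is odd. *)
Lemma radial_solution_opp (m : R) (sigma r v a : R -> R) :
  radial_solution m sigma r v a ->
  radial_solution m sigma (fun x => - r x) (fun x => - v x) (fun x => - a x).
Proof.
  intros [Hc H0 Hr Hv Ho]; split.
  - intros x Hx. apply filterlim_comp with (1 := Hc x Hx).
    apply (filterlim_opp (r x)).
  - rewrite H0; ring.
  - intros x Hx; apply (is_derive_opp r x (v x)); auto.
  - intros x Hx; apply (is_derive_opp v x (a x)); auto.
  - intros x Hx; specialize (Ho x Hx).
    replace (m * - r x * - v x / x) with (m * r x * v x / x) by (field; lra).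
    transitivity (- (m ^ 2 * r x / x)); [field; lra|].
    rewrite Ho; field; lra.
Qed.

(** Where v = 0, only the term r a / x of the derivative of d survives; as
    sigma >= 0, it reinforces the coefficient x of a. *)
Lemma critical_point_convex (m : R) (sigma r v a : R -> R) (x : R) :
  0 < m -> (forall s, 0 <= sigma s) ->
  radial_solution m sigma r v a ->
  0 < x < 1 -> v x = 0 -> 0 < r x -> 0 < a x.
Proof.
  intros Hm Hs H Hx Hv Hr.
  pose proof (rs_ode _ _ _ _ _ H x Hx) as Ho.
  rewrite Hv in Ho.
  set (s := sigma _) in Ho.
  assert (Hs0 : 0 <= s) by apply Hs.
  assert (Hl : 0 < m ^ 2 * r x / x).
  { apply Rdiv_lt_0_compat; [|lra]. apply Rmult_lt_0_compat; [|lra]. nra. }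
  assert (Hk : 0 <= m ^ 2 * s * r x ^ 2 / x).
  { apply Rmult_le_pos; [|left; apply Rinv_0_lt_compat; lra].
    repeat apply Rmult_le_pos; nra. }
  assert (He : m ^ 2 * r x / x = a x * (x + m ^ 2 * s * r x ^ 2 / x)).
  { rewrite Ho; field; lra. }
  nra.
Qed.

(** A positive maximum over [0,b] in (0,b) would be a critical point with a > 0. *)
Lemma weak_maximum_principle (m : R) (sigma r v a : R -> R) (b : R) :
  0 < m -> (forall s, 0 <= sigma s) ->
  radial_solution m sigma r v a ->
  0 <= b <= 1 -> forall y, 0 <= y <= b -> r y <= Rmax 0 (r b).
Proof.
  intros Hm Hs H Hb y Hy.
  destruct (attains_max r b (rs_cont _ _ _ _ _ H) Hb) as [c [Hc Hmax]].
  apply Rle_trans with (r c); [apply Hmax, Hy|].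
  destruct (Rle_lt_dec (r c) 0) as [Hn|Hp].
  { apply Rle_trans with (1 := Hn), Rmax_l. }
  destruct (Rle_lt_or_eq_dec c b) as [Hcb | ->]; [lra| |apply Rmax_r].
  assert (H0c : 0 < c).
  { destruct (Req_dec c 0) as [->|]; [|lra].
    rewrite (rs_at_0 _ _ _ _ _ H) in Hp; lra. }
  assert (Hv : v c = 0).
  { assert (Hd : derivable_pt_lim r c (v c)).
    { apply is_derive_Reals, (rs_dr _ _ _ _ _ H); lra. }
    pose (pr := exist _ (v c) Hd : derivable_pt r c).
    change (v c) with (derive_pt r c pr).
    apply deriv_maximum with 0 b; [lra|lra|].
    intros t Ht1 Ht2; apply Hmax; lra. }
  destruct (left_neighbour_above r v 0 c (a c)) as [t [Ht1 Ht2]].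
  - exact H0c.
  - intros t Ht; apply (rs_dr _ _ _ _ _ H); lra.
  - exact Hv.
  - apply (rs_dv _ _ _ _ _ H); lra.
  - apply (critical_point_convex m sigma r v a); auto; lra.
  - specialize (Hmax t); lra.
Qed.

(** The maximum principle for -r on [0,1] gives r >= 0; for r on [0,b], where
    r b = 0, it gives r <= 0 on [0,b]. *)
Lemma delayed_or_positive (m : R) (sigma r v a : R -> R) :
  0 < m -> (forall s, 0 <= sigma s) ->
  radial_solution m sigma r v a -> r 1 = 1 ->
  lifting_off_delayed r \/ (forall x, 0 < x <= 1 -> 0 < r x).
Proof.
  intros Hm Hs H H1.
  assert (Hnn : forall x, 0 <= x <= 1 -> 0 <= r x).
  { intros x Hx.
    assert (Hw := weak_maximum_principle m sigma _ _ _ 1 Hm Hs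
                    (radial_solution_opp _ _ _ _ _ H) ltac:(lra) x Hx).
    simpl in Hw. rewrite H1, Rmax_left in Hw by lra. lra. }
  destruct (classic (exists b, 0 < b < 1 /\ r b = 0)) as [[b [Hb Hrb]]|Hno].
  - left; exists b; split; [exact Hb|]; intros x Hx.
    assert (Hw := weak_maximum_principle m sigma r v a b Hm Hs H ltac:(lra) x Hx).
    rewrite Hrb, Rmax_left in Hw by lra.
    specialize (Hnn x ltac:(lra)). lra.
  - right; intros x Hx.
    destruct (Req_dec x 1) as [->|]; [lra|].
    destruct (Hnn x ltac:(lra)) as [|He]; [assumption|].
    exfalso; apply Hno; exists x; split; [lra|congruence].
Qed.

(** By the maximum principle r attains its maximum over [0,x] at x.  This excludes
    v x < 0 directly, and v x = 0 because a x > 0 would then put larger values to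
    the left of x. *)
Lemma velocity_positive (m : R) (sigma r v a : R -> R) :
  0 < m -> (forall s, 0 <= sigma s) ->
  radial_solution m sigma r v a ->
  (forall x, 0 < x < 1 -> 0 < r x) ->
  forall x, 0 < x < 1 -> 0 < v x.
Proof.
  intros Hm Hs H Hr x Hx.
  assert (Hmax : forall y, 0 <= y <= x -> r y <= r x).
  { intros y Hy.
    assert (Hw := weak_maximum_principle m sigma r v a x Hm Hs H ltac:(lra) y Hy).
    rewrite Rmax_right in Hw; [exact Hw|]. left; apply Hr, Hx. }
  destruct (Rtotal_order (v x) 0) as [Hn|[H0|]]; [| |assumption]; exfalso.
  - pose proof (rs_dr _ _ _ _ _ H x Hx) as Hd.
    apply is_derive_Reals in Hd.
    destruct (Hd (- v x)) as [e He]; [lra|].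
    pose proof (cond_pos e).
    set (h := Rmin (e / 2) (x / 2)).
    assert (h <= e / 2) by apply Rmin_l.
    assert (h <= x / 2) by apply Rmin_r.
    assert (0 < h) by (apply Rmin_pos; lra).
    assert (Hq : Rabs ((r (x + - h) - r x) / - h - v x) < - v x).
    { apply He; [lra|apply Rabs_def1; lra]. }
    apply Rabs_def2 in Hq.
    assert (Hle : r (x + - h) <= r x) by (apply Hmax; lra).
    assert (Hq2 : (r (x + - h) - r x) / - h < 0) by lra.
    assert (r (x + - h) - r x = (r (x + - h) - r x) / - h * - h) by (field; lra).
    nra.
  - destruct (left_neighbour_above r v 0 x (a x)) as [t [Ht1 Ht2]].
    + lra.
    + intros t Ht; apply (rs_dr _ _ _ _ _ H); lra.
    + exact H0.
    + apply (rs_dv _ _ _ _ _ H); lra.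
    + apply (critical_point_convex m sigma r v a); auto; lra.
    + specialize (Hmax t); lra.
Qed.

(** * The logarithmic slope *)

(** The derivative of ln r with respect to ln x; r = x^p has slope p. *)
Definition log_slope (r v : R -> R) (x : R) : R := x * v x / r x.

Definition log_slope' (r v a : R -> R) (x : R) : R :=
  (v x + x * a x) / r x - x * v x ^ 2 / r x ^ 2.

Lemma is_derive_log_slope (m : R) (sigma r v a : R -> R) (x : R) :
  radial_solution m sigma r v a -> 0 < x < 1 -> r x <> 0 ->
  is_derive (log_slope r v) x (log_slope' r v a x).
Proof.
  intros H Hx Hr.
  pose proof (rs_dr _ _ _ _ _ H x Hx) as Dr.
  pose proof (rs_dv _ _ _ _ _ H x Hx) as Dv.
  unfold log_slope, log_slope'.
  evar_last.
  - apply is_derive_div; [|exact Dr|exact Hr].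
    apply (is_derive_mult (fun y => y) v x 1 (a x) (is_derive_id x) Dv Rmult_comm).
  - unfold mult, plus; simpl; field; exact Hr.
Qed.

(** With x d' / d = 2 q - 2 + x q' / q, this is the equation multiplied by
    x q / r. *)
Lemma riccati (m : R) (sigma r v a : R -> R) (x : R) :
  radial_solution m sigma r v a -> 0 < x < 1 -> r x <> 0 ->
  let d := m * r x * v x / x in
  let w := m * sigma d * d in
  let q := log_slope r v x in
  x * log_slope' r v a x * (q + w) = q * (m ^ 2 - q ^ 2 - 2 * w * (q - 1)).
Proof.
  intros H Hx Hr d w q.
  pose proof (rs_ode _ _ _ _ _ H x Hx) as Ho.
  fold d in Ho.
  unfold w; set (s := sigma d) in *; clearbody s.
  apply Rminus_diag_eq in Ho.
  apply Rminus_diag_uniq.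
  (* The claimed identity is a multiple of the equation, with both sides moved to
     the left. *)
  match type of Ho with ?e = _ => transitivity (- (x * v x / r x) * (x / r x) * e) end.
  - unfold q, d, log_slope, log_slope'; field; lra.
  - rewrite Ho; ring.
Qed.

(** The two conditions on [sigma] put the weight w of the Riccati equation into
    [0,C]. *)
Record increasing_solution (m C : R) (sigma r v a : R -> R) : Prop := {
  inc_sol :> radial_solution m sigma r v a;
  inc_m : 2 <= m;
  inc_sigma_nonneg : forall s, 0 <= sigma s;
  inc_sigma_bound : forall s, 0 <= s -> m * sigma s * s <= C;
  inc_r_pos : forall x, 0 < x < 1 -> 0 < r x;
  inc_v_pos : forall x, 0 < x < 1 -> 0 < v x
}.

Lemma log_slope_pos (m C : R) (sigma r v a : R -> R) (x : R) :
  increasing_solution m C sigma r v a -> 0 < x < 1 -> 0 < log_slope r v x.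
Proof.
  intros H Hx.
  apply Rdiv_lt_0_compat; [apply Rmult_lt_0_compat|]; [lra| |].
  - apply (inc_v_pos _ _ _ _ _ _ H), Hx.
  - apply (inc_r_pos _ _ _ _ _ _ H), Hx.
Qed.

Lemma riccati_bounded (m C : R) (sigma r v a : R -> R) (x : R) :
  increasing_solution m C sigma r v a -> 0 < x < 1 ->
  let q := log_slope r v x in
  exists w, 0 <= w <= C /\
    x * log_slope' r v a x * (q + w) = q * (m ^ 2 - q ^ 2 - 2 * w * (q - 1)).
Proof.
  intros H Hx q.
  pose proof (inc_r_pos _ _ _ _ _ _ H x Hx) as Hr.
  pose proof (inc_v_pos _ _ _ _ _ _ H x Hx) as Hv.
  pose proof (inc_m _ _ _ _ _ _ H) as Hm.
  set (d := m * r x * v x / x).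
  assert (Hd : 0 <= d).
  { left; apply Rdiv_lt_0_compat; [|lra]. repeat apply Rmult_lt_0_compat; lra. }
  exists (m * sigma d * d). split; [split|].
  - apply Rmult_le_pos; [|exact Hd].
    apply Rmult_le_pos; [lra|apply (inc_sigma_nonneg _ _ _ _ _ _ H)].
  - apply (inc_sigma_bound _ _ _ _ _ _ H), Hd.
  - apply (riccati m sigma r v a x); [apply H|exact Hx|lra].
Qed.

(** Small enough for m^2 - q^2 - 2 w (q - 1) >= 2 whenever 0 < q < 1 + e,
    0 <= w <= C and m >= 2: there q^2 <= 1 + 3 e and w (q - 1) <= C e, while
    (3 + 2 C) e = 1. *)
Definition exponent_gain (C : R) : R := / (3 + 2 * C).

Lemma exponent_gain_bounds (C : R) : 0 <= C ->
  0 < exponent_gain C <= 1 /\ exponent_gain C * (3 + 2 * C) = 1.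
Proof.
  intros HC; unfold exponent_gain.
  assert (0 < / (3 + 2 * C)) by (apply Rinv_0_lt_compat; lra).
  assert (/ (3 + 2 * C) * (3 + 2 * C) = 1) by (field; lra).
  split; nra.
Qed.

(** The Riccati equation gives x q' (q + w) >= 2 q, where q + w <= 2 + C. *)
Lemma log_slope_growth_below (m C : R) (sigma r v a : R -> R) (x : R) :
  increasing_solution m C sigma r v a -> 0 <= C -> 0 < x < 1 ->
  log_slope r v x < 1 + exponent_gain C ->
  2 / (2 + C) * log_slope r v x <= x * log_slope' r v a x.
Proof.
  intros H HC Hx Hq.
  pose proof (log_slope_pos _ _ _ _ _ _ _ H Hx) as Hq0.
  pose proof (inc_m _ _ _ _ _ _ H) as Hm.
  destruct (exponent_gain_bounds C HC) as [Hg HgC].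
  destruct (riccati_bounded _ _ _ _ _ _ _ H Hx) as [w [Hw He]].
  set (q := log_slope r v x) in *; set (p := x * log_slope' r v a x) in *.
  set (e := exponent_gain C) in *.
  assert (Hf : 2 <= m ^ 2 - q ^ 2 - 2 * w * (q - 1)).
  { assert (4 <= m ^ 2) by nra.
    assert (q ^ 2 <= 1 + 3 * e) by nra.
    assert (w * (q - 1) <= C * e).
    { destruct (Rle_dec q 1); nra. }
    nra. }
  assert (Hp : 2 * q <= p * (q + w)) by nra.
  assert (Hpp : 0 < p) by nra.
  apply Rmult_le_reg_r with (2 + C); [lra|].
  replace (2 / (2 + C) * q * (2 + C)) with (2 * q) by (field; lra).
  nra.
Qed.

(** Here m^2 <= q^2 / 4, so that x q' (q + w) <= - (3/4) q^3, where
    q + w <= q (1 + C). *)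
Lemma log_slope_decay_above (m C : R) (sigma r v a : R -> R) (x : R) :
  increasing_solution m C sigma r v a -> 0 <= C -> 0 < x < 1 ->
  2 * m < log_slope r v x ->
  x * log_slope' r v a x <= - (3 / (4 * (1 + C))) * log_slope r v x ^ 2.
Proof.
  intros H HC Hx Hq.
  pose proof (inc_m _ _ _ _ _ _ H) as Hm.
  destruct (riccati_bounded _ _ _ _ _ _ _ H Hx) as [w [Hw He]].
  set (q := log_slope r v x) in *; set (p := x * log_slope' r v a x) in *.
  assert (Hf : m ^ 2 - q ^ 2 - 2 * w * (q - 1) <= - (3 / 4) * q ^ 2).
  { assert (0 <= w * (q - 1)) by (apply Rmult_le_pos; lra). nra. }
  assert (Hp : p * (q + w) <= q * (- (3 / 4) * q ^ 2)).
  { rewrite He. apply Rmult_le_compat_l; lra. }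
  assert (Hq2 : 0 < q ^ 2) by nra.
  assert (Hpn : p < 0).
  { apply Rnot_le_lt; intro Hn.
    assert (0 <= p * (q + w)) by (apply Rmult_le_pos; lra). nra. }
  assert (Hqw : q + w <= q * (1 + C)) by nra.
  assert (Hp2 : p * (q * (1 + C)) <= q * (- (3 / 4) * q ^ 2)) by nra.
  assert (Hp3 : p * (1 + C) <= - (3 / 4) * q ^ 2).
  { apply Rmult_le_reg_l with q; [lra|].
    replace (q * (p * (1 + C))) with (p * (q * (1 + C))) by ring. exact Hp2. }
  apply Rmult_le_reg_r with (1 + C); [lra|].
  replace (- (3 / (4 * (1 + C))) * q ^ 2 * (1 + C)) with (- (3 / 4) * q ^ 2)
    by (field; lra).
  exact Hp3.
Qed.

Lemma small_near_0 (m : R) (sigma r v a : R -> R) (eta : R) :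
  radial_solution m sigma r v a -> 0 < eta ->
  exists d, 0 < d /\ forall x, 0 <= x <= 1 -> x < d -> Rabs (r x) < eta.
Proof.
  intros H He.
  assert (H0 : Icc 0 1 0) by (split; lra).
  pose proof (rs_cont _ _ _ _ _ H 0 H0) as Hc.
  rewrite (rs_at_0 _ _ _ _ _ H) in Hc.
  apply filterlim_locally with (eps := mkposreal eta He) in Hc.
  destruct Hc as [d Hd].
  exists d; split; [apply cond_pos|]; intros x Hx Hxd.
  assert (Hb : ball 0 (mkposreal eta He) (r x)).
  { apply Hd; [|exact Hx].
    unfold ball; simpl; unfold AbsRing_ball, abs, minus, plus, opp; simpl.
    apply Rabs_def1; lra. }
  unfold ball in Hb; simpl in Hb; unfold AbsRing_ball, abs, minus, plus, opp in Hb.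
  simpl in Hb. replace (r x + - 0) with (r x) in Hb by ring. exact Hb.
Qed.

(** A slope below the threshold would decay at least like a power of x towards 0,
    making its integral against dx / x, which is ln r, converge at 0: precisely,
    q - k ln r is nondecreasing, and r could not tend to 0. *)
Lemma log_slope_lower (m C : R) (sigma r v a : R -> R) (x : R) :
  increasing_solution m C sigma r v a -> 0 <= C -> 0 < x < 1 ->
  1 + exponent_gain C <= log_slope r v x.
Proof.
  intros H HC Hx.
  apply Rnot_lt_le; intro Hq.
  set (k := 2 / (2 + C)).
  assert (Hk : 0 < k) by (apply Rdiv_lt_0_compat; lra).
  assert (Hgrow : forall y, 0 < y < 1 -> log_slope r v y < 1 + exponent_gain C ->
            k * v y / r y <= log_slope' r v a y).
  { intros y Hy Hqy.
    pose proof (inc_r_pos _ _ _ _ _ _ H y Hy).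
    apply Rmult_le_reg_l with y; [lra|].
    apply Rle_trans with (2 := log_slope_growth_below _ _ _ _ _ _ _ H HC Hy Hqy).
    right; unfold log_slope, k; field; lra. }
  assert (Hbar : forall y, 0 < y <= x -> log_slope r v y < 1 + exponent_gain C).
  { apply barrier_below with (log_slope' r v a); [| |exact Hq].
    - intros y Hy.
      pose proof (inc_r_pos _ _ _ _ _ _ H y ltac:(lra)).
      apply (is_derive_log_slope m sigma); [apply H|lra|lra].
    - intros y Hy Hqy.
      apply Rle_trans with (2 := Hgrow y ltac:(lra) Hqy).
      pose proof (inc_r_pos _ _ _ _ _ _ H y ltac:(lra)).
      pose proof (inc_v_pos _ _ _ _ _ _ H y ltac:(lra)).
      left; apply Rdiv_lt_0_compat; [apply Rmult_lt_0_compat|]; assumption. }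
  set (g := fun y => log_slope r v y - k * ln (r y)).
  assert (Hmono : forall y, 0 < y <= x -> g y <= g x).
  { intros y Hy.
    apply nondecreasing_of_derive
      with (fun t => log_slope' r v a t - k * (v t / r t)); [lra| |].
    - intros t Ht.
      pose proof (inc_r_pos _ _ _ _ _ _ H t ltac:(lra)) as Hrt.
      unfold g.
      apply (is_derive_minus (V := R_NormedModule)).
      + apply (is_derive_log_slope m sigma); [apply H|lra|lra].
      + apply is_derive_scal.
        evar_last.
        * apply (is_derive_comp ln r); [apply is_derive_ln, Hrt|].
          apply (rs_dr _ _ _ _ _ H); lra.
        * unfold scal; simpl; unfold mult; simpl; field; lra.
    - intros t Ht.
      pose proof (Hgrow t ltac:(lra) (Hbar t ltac:(lra))).
      replace (k * (v t / r t)) with (k * v t / r t) by (unfold Rdiv; ring). lra. }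
  (* r y < eta means k ln (r y) < - g x, hence g y > g x because q > 0. *)
  set (eta := exp (- g x / k)).
  destruct (small_near_0 m sigma r v a eta H (exp_pos _)) as [d [Hd Hsm]].
  set (y := Rmin x (d / 2)).
  assert (y <= x) by apply Rmin_l.
  assert (y <= d / 2) by apply Rmin_r.
  assert (Hy : 0 < y) by (apply Rmin_pos; lra).
  pose proof (inc_r_pos _ _ _ _ _ _ H y ltac:(lra)) as Hry.
  pose proof (log_slope_pos _ _ _ _ _ _ y H ltac:(lra)) as Hqy.
  specialize (Hsm y ltac:(lra) ltac:(lra)).
  rewrite Rabs_right in Hsm by lra.
  apply ln_increasing in Hsm; [|exact Hry].
  unfold eta in Hsm; rewrite ln_exp in Hsm.
  specialize (Hmono y ltac:(lra)). unfold g at 1 in Hmono.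
  assert (k * ln (r y) < - g x); [|lra].
  replace (- g x) with (k * (- g x / k)) by (field; lra).
  apply Rmult_lt_compat_l; assumption.
Qed.

(** A slope above 2 m would blow up before 0 is reached: 1/q - k ln x is
    nondecreasing, and 1/q > 0 fails once k ln x is below a constant. *)
Lemma log_slope_upper (m C : R) (sigma r v a : R -> R) (x : R) :
  increasing_solution m C sigma r v a -> 0 <= C -> 0 < x < 1 ->
  log_slope r v x <= 2 * m.
Proof.
  intros H HC Hx.
  apply Rnot_lt_le; intro Hq.
  pose proof (inc_m _ _ _ _ _ _ H) as Hm.
  set (k := 3 / (4 * (1 + C))).
  assert (Hk : 0 < k) by (apply Rdiv_lt_0_compat; lra).
  assert (Hder : forall y, 0 < y < 1 ->
            is_derive (log_slope r v) y (log_slope' r v a y)).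
  { intros y Hy; pose proof (inc_r_pos _ _ _ _ _ _ H y Hy).
    apply (is_derive_log_slope m sigma); [apply H|lra|lra]. }
  assert (Hdec : forall y, 0 < y < 1 -> 2 * m < log_slope r v y ->
            log_slope' r v a y <= - (k / y) * log_slope r v y ^ 2).
  { intros y Hy Hqy.
    apply Rmult_le_reg_l with y; [lra|].
    apply Rle_trans with (1 := log_slope_decay_above _ _ _ _ _ _ _ H HC Hy Hqy).
    right; unfold k; field; lra. }
  assert (Hbar : forall y, 0 < y <= x -> - log_slope r v y < - (2 * m)).
  { apply barrier_below with (fun y => - log_slope' r v a y); [| |lra].
    - intros y Hy; apply (is_derive_opp (log_slope r v)), Hder; lra.
    - intros y Hy Hqy.
      specialize (Hdec y ltac:(lra) ltac:(lra)).
      assert (0 < k / y) by (apply Rdiv_lt_0_compat; lra).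
      assert (0 <= log_slope r v y ^ 2) by apply pow2_ge_0. nra. }
  set (g := fun y => / log_slope r v y - k * ln y).
  assert (Hmono : forall y, 0 < y <= x -> g y <= g x).
  { intros y Hy.
    apply nondecreasing_of_derive
      with (fun t => - log_slope' r v a t / log_slope r v t ^ 2 - k * / t); [lra| |].
    - intros t Ht.
      pose proof (Hbar t ltac:(lra)).
      apply (is_derive_minus (V := R_NormedModule)).
      + apply is_derive_inv; [apply Hder|]; lra.
      + apply is_derive_scal, is_derive_ln; lra.
    - intros t Ht.
      pose proof (Hbar t ltac:(lra)) as Hqt.
      specialize (Hdec t ltac:(lra) ltac:(lra)).
      assert (Hq2 : 0 < log_slope r v t ^ 2) by nra.
      apply Rmult_le_reg_r with (log_slope r v t ^ 2); [exact Hq2|].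
      replace ((- log_slope' r v a t / log_slope r v t ^ 2 - k * / t)
               * log_slope r v t ^ 2)
        with (- log_slope' r v a t - k / t * log_slope r v t ^ 2) by (field; lra).
      lra. }
  set (y := Rmin x (exp (- g x / k))).
  assert (y <= x) by apply Rmin_l.
  assert (Hye : y <= exp (- g x / k)) by apply Rmin_r.
  assert (Hy : 0 < y) by (apply Rmin_pos; [lra|apply exp_pos]).
  specialize (Hmono y ltac:(lra)). unfold g at 1 in Hmono.
  assert (0 < / log_slope r v y).
  { apply Rinv_0_lt_compat. pose proof (Hbar y ltac:(lra)); lra. }
  apply ln_le in Hye; [|exact Hy].
  rewrite ln_exp in Hye.
  assert (k * ln y <= - g x); [|lra].
  replace (- g x) with (k * (- g x / k)) by (field; lra).
  apply Rmult_le_compat_l; lra.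
Qed.

(** The lower bound on the slope says that ln r - (1 + e) ln x is nondecreasing on
    (0,1).  At 1 it is at most 0, since r <= 1 by the maximum principle. *)
Lemma power_growth (m C : R) (sigma r v a : R -> R) (x : R) :
  increasing_solution m C sigma r v a -> 0 <= C -> r 1 = 1 -> 0 < x < 1 ->
  r x <= x * Rpower x (exponent_gain C).
Proof.
  intros H HC H1 Hx.
  set (e := exponent_gain C).
  destruct (exponent_gain_bounds C HC) as [Hg _]; fold e in Hg.
  pose proof (inc_m _ _ _ _ _ _ H) as Hm.
  set (h := fun y => ln (r y) - (1 + e) * ln y).
  assert (Hmono : forall y, x <= y < 1 -> h x <= h y).
  { intros y Hy.
    apply nondecreasing_of_derive with (fun t => v t / r t - (1 + e) * / t); [lra| |].
    - intros t Ht.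
      pose proof (inc_r_pos _ _ _ _ _ _ H t ltac:(lra)) as Hrt.
      apply (is_derive_minus (V := R_NormedModule)).
      + evar_last.
        * apply (is_derive_comp ln r); [apply is_derive_ln, Hrt|].
          apply (rs_dr _ _ _ _ _ H); lra.
        * unfold scal; simpl; unfold mult; simpl; field; lra.
      + apply is_derive_scal, is_derive_ln; lra.
    - intros t Ht.
      pose proof (inc_r_pos _ _ _ _ _ _ H t ltac:(lra)) as Hrt.
      pose proof (log_slope_lower _ _ _ _ _ _ t H HC ltac:(lra)) as Hq.
      fold e in Hq; unfold log_slope in Hq.
      apply Rmult_le_reg_l with t; [lra|].
      replace (t * (v t / r t - (1 + e) * / t)) with (t * v t / r t - (1 + e))
        by (field; lra). lra. }
  assert (Hend : forall y, x <= y < 1 -> h x <= - (1 + e) * ln y).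
  { intros y Hy; apply Rle_trans with (1 := Hmono y Hy).
    pose proof (inc_r_pos _ _ _ _ _ _ H y ltac:(lra)) as Hry.
    assert (Hw := weak_maximum_principle m sigma r v a 1 ltac:(lra)
                    (inc_sigma_nonneg _ _ _ _ _ _ H) H ltac:(lra) y ltac:(lra)).
    rewrite H1, Rmax_right in Hw by lra.
    apply ln_le in Hw; [|exact Hry]. rewrite ln_1 in Hw.
    unfold h; lra. }
  assert (Hh : h x <= 0).
  { apply Rnot_lt_le; intro Hp.
    (* At z the bound - (1 + e) ln z equals h x / 2. *)
    set (z := exp (- h x / (2 * (1 + e)))).
    assert (Hz : - h x / (2 * (1 + e)) < 0).
    { unfold Rdiv. assert (0 < / (2 * (1 + e))) by (apply Rinv_0_lt_compat; lra). nra. }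
    assert (Hz1 : z < 1)
      by (rewrite <- exp_0; apply exp_increasing, Hz).
    assert (Hxy := Rmax_l x z). assert (Hzy := Rmax_r x z).
    assert (Hy1 : Rmax x z < 1) by (apply Rmax_lub_lt; lra).
    specialize (Hend (Rmax x z) ltac:(lra)).
    apply ln_le in Hzy; [|apply exp_pos].
    unfold z at 1 in Hzy; rewrite ln_exp in Hzy.
    apply Rmult_le_compat_l with (r := 1 + e) in Hzy; [|lra].
    replace ((1 + e) * (- h x / (2 * (1 + e)))) with (- h x / 2) in Hzy by (field; lra).
    lra. }
  pose proof (inc_r_pos _ _ _ _ _ _ H x Hx) as Hr.
  rewrite <- (exp_ln (r x)) by exact Hr.
  rewrite <- (exp_ln x) at 2 by lra.
  unfold Rpower; rewrite <- exp_plus.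
  assert (Hle : ln (r x) <= ln x + e * ln x) by (unfold h in Hh; lra).
  destruct Hle as [Hlt | ->]; [left; apply exp_increasing, Hlt|right; reflexivity].
Qed.

Lemma ratio_bounds (m C : R) (sigma r v a : R -> R) (x : R) :
  increasing_solution m C sigma r v a -> 0 <= C -> r 1 = 1 -> 0 < x < 1 ->
  0 < r x / x <= Rpower x (exponent_gain C).
Proof.
  intros H HC H1 Hx.
  pose proof (inc_r_pos _ _ _ _ _ _ H x Hx) as Hr.
  pose proof (power_growth _ _ _ _ _ _ _ H HC H1 Hx) as Hg.
  split; [apply Rdiv_lt_0_compat; lra|].
  apply Rmult_le_reg_r with x; [lra|].
  replace (r x / x * x) with (r x) by (field; lra). lra.
Qed.

Lemma velocity_growth (m C : R) (sigma r v a : R -> R) (x : R) :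
  increasing_solution m C sigma r v a -> 0 <= C -> r 1 = 1 -> 0 < x < 1 ->
  v x <= 2 * m * Rpower x (exponent_gain C).
Proof.
  intros H HC H1 Hx.
  pose proof (inc_r_pos _ _ _ _ _ _ H x Hx) as Hr.
  pose proof (inc_m _ _ _ _ _ _ H) as Hm.
  pose proof (power_growth _ _ _ _ _ _ _ H HC H1 Hx) as Hg.
  pose proof (log_slope_upper _ _ _ _ _ _ _ H HC Hx) as Hq.
  unfold log_slope in Hq.
  apply Rmult_le_reg_l with x; [lra|].
  apply Rle_trans with (2 * m * r x).
  - apply Rmult_le_compat_r with (r := r x) in Hq; [|lra].
    replace (x * v x / r x * r x) with (x * v x) in Hq by (field; lra). exact Hq.
  - replace (x * (2 * m * Rpower x (exponent_gain C)))
      with (2 * m * (x * Rpower x (exponent_gain C))) by ring.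
    apply Rmult_le_compat_l; lra.
Qed.

Lemma Rpower_small (e eta : R) :
  0 < e -> 0 < eta ->
  exists d, 0 < d /\ forall x, 0 < x < d -> Rpower x e < eta.
Proof.
  intros He Heta.
  exists (Rpower eta (/ e)); split; [apply exp_pos|].
  intros x Hx.
  replace eta with (Rpower (Rpower eta (/ e)) e).
  - apply Rlt_Rpower_l; [exact He|exact Hx].
  - rewrite Rpower_mult, Rinv_l by lra. apply Rpower_1, Heta.
Qed.

(** * One-sided derivatives and extension by zero *)

Lemma interior_derive (f f' : R -> R) (x : R) :
  D_in f f' (Ioc 0 1) x -> 0 < x < 1 -> is_derive f x (f' x).
Proof.
  intros H Hx; apply is_derive_Reals; intros eps Heps.
  destruct (H eps Heps) as [d [Hd Hlim]].
  assert (Hdp : 0 < Rmin d (Rmin x (1 - x))) by (repeat apply Rmin_pos; lra).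
  exists (mkposreal _ Hdp); simpl; intros h Hh0 Hh.
  assert (H1 := Rmin_l d (Rmin x (1 - x))).
  assert (H2 := Rmin_r d (Rmin x (1 - x))).
  assert (H3 := Rmin_l x (1 - x)).
  assert (H4 := Rmin_r x (1 - x)).
  assert (Hb : Rabs h < x) by lra. assert (Hb' : Rabs h < 1 - x) by lra.
  apply Rabs_def2 in Hb; apply Rabs_def2 in Hb'.
  specialize (Hlim (x + h)); simpl in Hlim; unfold R_dist in Hlim.
  replace (x + h - x) with h in Hlim by ring.
  apply Hlim; split; [split; [split|]|]; lra.
Qed.

Lemma filterlim_of_D_in (f f' : R -> R) (D : R -> Prop) (x : R) :
  D_in f f' D x -> filterlim f (within D (locally x)) (locally (f x)).
Proof.
  intros H; apply cont_deriv in H.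
  apply filterlim_locally; intros eps.
  destruct (H eps (cond_pos eps)) as [d [Hd Hlim]].
  exists (mkposreal d Hd); intros y Hy HDy.
  destruct (Req_dec y x) as [->|Hne]; [apply ball_center|].
  apply (Hlim y); split; [split; [exact HDy|congruence]|exact Hy].
Qed.

Definition zero_ext (f : R -> R) (x : R) : R := if Rle_dec x 0 then 0 else f x.

Lemma zero_ext_pos (f : R -> R) (x : R) : 0 < x -> zero_ext f x = f x.
Proof. unfold zero_ext; destruct Rle_dec; [lra|reflexivity]. Qed.

Lemma zero_ext_0 (f : R -> R) : zero_ext f 0 = 0.
Proof. unfold zero_ext; destruct Rle_dec; [reflexivity|lra]. Qed.

(** Differentiability at x > 0 concerns only the points closer to x than 0 is. *)
Lemma D_in_Icc_of_Ioc (f f' g g' : R -> R) (x : R) :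
  0 < x <= 1 -> (forall y, 0 < y <= 1 -> g y = f y) -> g' x = f' x ->
  D_in f f' (Ioc 0 1) x -> D_in g g' (Icc 0 1) x.
Proof.
  intros Hx Hfg Hd H eps Heps.
  destruct (H eps Heps) as [d [Hdp Hlim]].
  exists (Rmin d x); split; [apply Rmin_pos; lra|].
  intros y [[Hy Hne] Hdist].
  assert (H1 := Rmin_l d x). assert (H2 := Rmin_r d x).
  simpl in *; unfold R_dist in *; unfold Icc in Hy.
  assert (Hyx : Rabs (y - x) < x) by lra. apply Rabs_def2 in Hyx.
  rewrite !Hfg, Hd by lra.
  apply Hlim; split; [split; [split|]|]; lra.
Qed.

(** * The second derivative of rho *)

(** If f'' s < 0, the function h -> - (f (s + h) + f (s - h)) has a critical point
    with positive second derivative at 0, so it takes a larger value than at 0; this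
    contradicts midpoint convexity. *)
Lemma convex_second_derivative_nonneg (f : R -> R) (s : R) :
  (forall n t, ex_derive_n f n t) -> convex_on (fun _ => True) f ->
  0 <= Derive_n f 2 s.
Proof.
  intros Hf Hc; apply Rnot_lt_le; intro Hneg.
  assert (D1 : forall t, is_derive f t (Derive f t)).
  { intro t; apply Derive_correct, (Hf 1%nat). }
  assert (D2 : forall t, is_derive (Derive f) t (Derive_n f 2 t)).
  { intro t; apply Derive_correct, (Hf 2%nat). }
  destruct (left_neighbour_above
              (fun h => - (f (s + h) + f (s - h)))
              (fun h => - (Derive f (s + h) - Derive f (s - h)))
              (-1) 0 (- 2 * Derive_n f 2 s)) as [h [Hh Hlt]].
  - lra.
  - intros t _. evar_last.
    + apply (is_derive_opp (fun h => f (s + h) + f (s - h))).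
      apply (is_derive_plus (fun h => f (s + h)) (fun h => f (s - h))).
      * apply (is_derive_comp f (fun h => s + h)); [apply D1|].
        apply (is_derive_plus (fun _ => s) (fun h => h));
          [apply is_derive_const|apply is_derive_id].
      * apply (is_derive_comp f (fun h => s - h)); [apply D1|].
        apply (is_derive_minus (fun _ => s) (fun h => h));
          [apply is_derive_const|apply is_derive_id].
    + unfold minus, plus, opp, scal, zero, one; simpl; unfold mult; simpl; ring.
  - rewrite Rplus_0_r, Rminus_0_r; ring.
  - evar_last.
    + apply (is_derive_opp (fun h => Derive f (s + h) - Derive f (s - h))).
      apply (is_derive_minus (fun h => Derive f (s + h)) (fun h => Derive f (s - h))).
      * apply (is_derive_comp (Derive f) (fun h => s + h)); [apply D2|].
        apply (is_derive_plus (fun _ => s) (fun h => h));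
          [apply is_derive_const|apply is_derive_id].
      * apply (is_derive_comp (Derive f) (fun h => s - h)); [apply D2|].
        apply (is_derive_minus (fun _ => s) (fun h => h));
          [apply is_derive_const|apply is_derive_id].
    + rewrite Rplus_0_r, Rminus_0_r.
      unfold minus, plus, opp, scal, zero, one; simpl; unfold mult; simpl; ring.
  - lra.
  - rewrite Rplus_0_r, Rminus_0_r in Hlt.
    assert (Hm := Hc (s + h) (s - h) (1 / 2) I I ltac:(lra)).
    replace (1 / 2 * (s + h) + (1 - 1 / 2) * (s - h)) with s in Hm by field. lra.
Qed.

Lemma affine_second_derivative (gamma kappa s : R) :
  Derive_n (fun t => gamma * t + kappa) 2 s = 0.
Proof.
  simpl. rewrite (Derive_ext _ (fun _ => gamma)).
  - apply Derive_const.
  - intro t; apply is_derive_unique; auto_derive; [exact I|ring].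
Qed.

(** On [0,s0] by continuity and compactness; beyond s0, rho is affine. *)
Lemma second_derivative_bound (gamma s0 kappa : R) (rho1 rho : R -> R) (m : R) :
  0 < m -> admissible_rho gamma s0 kappa rho1 rho ->
  exists C, 0 <= C /\ forall s, 0 <= s -> m * Derive_n rho 2 s * s <= C.
Proof.
  intros Hm H.
  assert (Hs0 := s0_nonneg _ _ _ _ _ H).
  destruct (continuity_ab_maj (fun s => m * Derive_n rho 2 s * s) 0 s0 Hs0)
    as [z [Hz Hin]].
  { intros s Hs. apply continuity_pt_mult; [|apply continuity_pt_id].
    apply continuity_pt_mult; [apply continuity_pt_const; intros ? ?; reflexivity|].
    apply continuity_pt_filterlim.
    apply (ex_derive_continuous (Derive_n rho 2)).
    apply (rho_smooth _ _ _ _ _ H 3%nat). }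
  exists (m * Derive_n rho 2 z * z).
  assert (Hz0 := Hz 0 ltac:(lra)); simpl in Hz, Hz0.
  rewrite Rmult_0_r in Hz0.
  split; [exact Hz0|]; intros s Hs.
  destruct (Rle_lt_dec s s0) as [Hle|Hlt]; [apply Hz; lra|].
  rewrite (Derive_n_ext_loc rho (fun t => gamma * t + kappa)).
  - rewrite affine_second_derivative, Rmult_0_r, Rmult_0_l; exact Hz0.
  - assert (Hp : 0 < s - s0) by lra.
    exists (mkposreal _ Hp); intros t Ht.
    apply (rho_affine _ _ _ _ _ H).
    apply Rabs_def2 in Ht; unfold minus, plus, opp in Ht; simpl in Ht; lra.
Qed.

(** * From the boundary value problem to the conclusions *)

Lemma locally_open_unit (x : R) (P : R -> Prop) :
  0 < x < 1 -> (forall y, 0 < y < 1 -> P y) -> locally x P.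
Proof.
  intros Hx HP.
  apply (locally_interval P x (Finite 0) (Finite 1)); simpl; try lra.
  intros y H0 H1; apply HP; lra.
Qed.

Section Jet.

Variables (r : R -> R) (F : nat -> R -> R).
Hypothesis HF0 : forall x, Ioc 0 1 x -> F 0%nat x = r x.
Hypothesis HFS : forall k x, Ioc 0 1 x -> D_in (F k) (F (S k)) (Ioc 0 1) x.

Lemma jet_derive (k : nat) (x : R) : 0 < x < 1 -> is_derive (F k) x (F (S k) x).
Proof. intros Hx; apply interior_derive; [apply HFS; split; lra|exact Hx]. Qed.

Lemma jet_derive_0 (x : R) : 0 < x < 1 -> is_derive r x (F 1%nat x).
Proof.
  intros Hx; apply is_derive_ext_loc with (F 0%nat); [|apply jet_derive, Hx].
  apply locally_open_unit; [exact Hx|]; intros y Hy; apply HF0; split; lra.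
Qed.

Lemma jac_jet (M : nat) (x : R) :
  0 < x < 1 -> jac M r x = INR M * r x * F 1%nat x / x.
Proof.
  intros Hx; unfold jac; rewrite (is_derive_unique _ _ _ (jet_derive_0 x Hx)).
  reflexivity.
Qed.

(** On (0,1) the two-sided derivatives in the boundary value problem are the
    members of the one-sided family [F]. *)
Lemma bvp_radial_solution (M : nat) (rho : R -> R) :
  continuous_on (Icc 0 1) r -> solves_bvp M rho r ->
  radial_solution (INR M) (Derive_n rho 2) r (F 1%nat) (F 2%nat).
Proof.
  intros Hc Hb; split; try assumption.
  - apply (bvp_0 _ _ _ Hb).
  - exact jet_derive_0.
  - apply jet_derive.
  - intros x Hx.
    assert (D1 : Derive r x = F 1%nat x) by apply is_derive_unique, jet_derive_0, Hx.
    assert (D2 : Derive_n r 2 x = F 2%nat x).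
    { apply is_derive_unique.
      apply is_derive_ext_loc with (F 1%nat); [|apply jet_derive, Hx].
      apply locally_open_unit; [exact Hx|]; intros y Hy; symmetry.
      apply is_derive_unique, jet_derive_0, Hy. }
    assert (D3 : Derive (jac M r) x =
              INR M * ((F 1%nat x ^ 2 + r x * F 2%nat x) / x
                       - r x * F 1%nat x / x ^ 2)).
    { apply is_derive_unique.
      apply is_derive_ext_loc with (fun y => INR M * (r y * F 1%nat y / y)).
      - apply locally_open_unit; [exact Hx|]; intros y Hy.
        rewrite jac_jet by exact Hy.
        change (@eq R (INR M * (r y * F 1%nat y / y)) (INR M * r y * F 1%nat y / y)).
        field; lra.
      - apply is_derive_scal. evar_last.
        + apply is_derive_div; [|apply is_derive_id|lra].
          apply (is_derive_mult r (F 1%nat) x);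
            [apply jet_derive_0, Hx|apply jet_derive, Hx|exact Rmult_comm].
        + unfold mult, plus, one; simpl; field; lra. }
    rewrite <- jac_jet, <- D3, <- D2, <- D1 by exact Hx.
    apply (bvp_ode _ _ _ Hb x Hx).
Qed.

Lemma delayed_jet_zero (d : R) :
  d < 1 -> (forall x, 0 <= x <= d -> r x = 0) ->
  forall k x, 0 < x < d -> F k x = 0.
Proof.
  intros Hd Hr k; induction k as [|k IH]; intros x Hx.
  - rewrite HF0 by (split; lra). apply Hr; lra.
  - transitivity (Derive (F k) x).
    + symmetry; apply is_derive_unique, jet_derive; lra.
    + rewrite (Derive_ext_loc _ (fun _ => 0)); [apply Derive_const|].
      apply (locally_interval _ x (Finite 0) (Finite d)); simpl; try lra.
      intros y H0 H1; apply IH; lra.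
Qed.

Lemma delayed_smooth : lifting_off_delayed r -> smooth_on (Icc 0 1) r.
Proof.
  intros [d [Hd Hr]].
  exists (fun k => zero_ext (F k)); split.
  - intros x [Hx0 Hx1].
    destruct Hx0 as [Hx0| <-].
    + rewrite zero_ext_pos by exact Hx0. apply HF0; split; assumption.
    + rewrite zero_ext_0; symmetry; apply Hr; lra.
  - intros k x [Hx0 Hx1].
    destruct Hx0 as [Hx0| <-].
    + apply D_in_Icc_of_Ioc with (F k) (F (S k)); [lra| | |apply HFS; split; lra].
      * intros y Hy; apply zero_ext_pos; lra.
      * apply zero_ext_pos, Hx0.
    + intros eps Heps; exists d; split; [lra|].
      intros y [[[Hy0 Hy1] Hne] Hdist]; simpl in *; unfold R_dist in *.
      apply Rabs_def2 in Hdist.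
      rewrite !zero_ext_0, zero_ext_pos, (delayed_jet_zero d) by (try exact Hr; lra).
      replace ((0 - 0) / (y - 0) - 0) with 0 by (field; lra).
      rewrite Rabs_R0; exact Heps.
Qed.

Lemma delayed_jac_limit (M : nat) :
  lifting_off_delayed r -> filterlim (jac M r) (at_right 0) (locally 0).
Proof.
  intros [d [Hd Hr]].
  apply filterlim_locally; intros eps.
  assert (Hdp : 0 < d) by lra.
  exists (mkposreal d Hdp); intros x Hx Hx0.
  apply Rabs_def2 in Hx; unfold minus, plus, opp in Hx; simpl in Hx.
  rewrite jac_jet, Hr by lra.
  replace (INR M * 0 * F 1%nat x / x) with 0 by (field; lra).
  apply ball_center.
Qed.

Section Increasing.

Variables (m C : R) (sigma : R -> R).
Hypothesis HC : 0 <= C.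
Hypothesis H1 : r 1 = 1.
Hypothesis H : increasing_solution m C sigma r (F 1%nat) (F 2%nat).

Lemma increasing_jac_limit (M : nat) :
  INR M = m -> filterlim (jac M r) (at_right 0) (locally 0).
Proof.
  intros HM.
  pose proof (inc_m _ _ _ _ _ _ H) as Hm.
  destruct (exponent_gain_bounds C HC) as [Hg _].
  apply filterlim_locally; intros eps.
  assert (Hd : 0 < Rmin 1 (eps / (2 * m ^ 2))).
  { apply Rmin_pos; [lra|]. apply Rdiv_lt_0_compat; [apply cond_pos|nra]. }
  destruct (Rpower_small (exponent_gain C) _ (proj1 Hg) Hd) as [d [Hdp Hsm]].
  assert (Hd1 : 0 < Rmin d 1) by (apply Rmin_pos; lra).
  exists (mkposreal _ Hd1); intros x Hx Hx0.
  apply Rabs_def2 in Hx; unfold minus, plus, opp in Hx; simpl in Hx.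
  assert (A1 := Rmin_l d 1). assert (A2 := Rmin_r d 1).
  specialize (Hsm x ltac:(lra)).
  assert (A3 := Rmin_l 1 (eps / (2 * m ^ 2))).
  assert (A4 := Rmin_r 1 (eps / (2 * m ^ 2))).
  assert (Hx1 : 0 < x < 1) by lra.
  assert (Hv := inc_v_pos _ _ _ _ _ _ H x Hx1).
  assert (Hrx := ratio_bounds _ _ _ _ _ _ _ H HC H1 Hx1).
  assert (Hgv := velocity_growth _ _ _ _ _ _ _ H HC H1 Hx1).
  rewrite jac_jet, HM by exact Hx1.
  set (p := Rpower x (exponent_gain C)) in *.
  assert (Hp : 0 < p) by apply exp_pos.
  replace (m * r x * F 1%nat x / x) with (m * (r x / x * F 1%nat x)) by (field; lra).
  assert (Hprod : r x / x * F 1%nat x <= p * (2 * m * p)).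
  { apply Rmult_le_compat; lra. }
  assert (Hprod0 : 0 < r x / x * F 1%nat x) by (apply Rmult_lt_0_compat; lra).
  assert (Hpe : 2 * m ^ 2 * p < eps).
  { apply Rmult_lt_reg_r with (/ (2 * m ^ 2)); [apply Rinv_0_lt_compat; nra|].
    replace (2 * m ^ 2 * p * / (2 * m ^ 2)) with p by (field; lra).
    unfold Rdiv in A4; lra. }
  assert (Hpp : p * p <= p) by nra.
  apply Rabs_def1; unfold minus, plus, opp; simpl; nra.
Qed.

Lemma increasing_derivative_0 : D_in r (fun _ => 0) (Icc 0 1) 0.
Proof.
  destruct (exponent_gain_bounds C HC) as [Hg _].
  intros eps Heps.
  destruct (Rpower_small (exponent_gain C) eps (proj1 Hg) Heps) as [d [Hdp Hsm]].
  exists (Rmin d 1); split; [apply Rmin_pos; lra|].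
  intros x [[[Hx0 Hx1] Hne] Hdist]; simpl in *; unfold R_dist in *.
  assert (A1 := Rmin_l d 1). assert (A2 := Rmin_r d 1).
  apply Rabs_def2 in Hdist.
  assert (Hx : 0 < x < 1) by lra.
  specialize (Hsm x ltac:(lra)).
  assert (Hrx := ratio_bounds _ _ _ _ _ _ _ H HC H1 Hx).
  rewrite (rs_at_0 _ _ _ _ _ H).
  replace ((r x - 0) / (x - 0) - 0) with (r x / x) by (field; lra).
  apply Rabs_def1; lra.
Qed.

Lemma increasing_C1 : C1_on (Icc 0 1) r.
Proof.
  exists (zero_ext (F 1%nat)); split.
  - intros x [[Hx0| <-] Hx1].
    + apply D_in_Icc_of_Ioc with (F 0%nat) (F 1%nat); [lra| | |apply HFS; split; lra].
      * intros y Hy; symmetry; apply HF0; split; lra.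
      * apply zero_ext_pos, Hx0.
    + intros eps Heps; rewrite zero_ext_0. exact (increasing_derivative_0 eps Heps).
  - intros x [[Hx0| <-] Hx1].
    + apply filterlim_of_D_in with (zero_ext (F 2%nat)).
      apply D_in_Icc_of_Ioc with (F 1%nat) (F 2%nat); [lra| | |apply HFS; split; lra].
      * intros y Hy; apply zero_ext_pos; lra.
      * apply zero_ext_pos, Hx0.
    + pose proof (inc_m _ _ _ _ _ _ H) as Hm.
      destruct (exponent_gain_bounds C HC) as [Hg _].
      rewrite zero_ext_0; apply filterlim_locally; intros eps.
      assert (He : 0 < eps / (2 * m)).
      { apply Rdiv_lt_0_compat; [apply cond_pos|lra]. }
      destruct (Rpower_small (exponent_gain C) _ (proj1 Hg) He) as [d [Hdp Hsm]].
      assert (Hd1 : 0 < Rmin d 1) by (apply Rmin_pos; lra).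
      exists (mkposreal _ Hd1); intros x Hx [[Hx0| <-] _];
        [|rewrite zero_ext_0; apply ball_center].
      apply Rabs_def2 in Hx; unfold minus, plus, opp in Hx; simpl in Hx.
      assert (A1 := Rmin_l d 1). assert (A2 := Rmin_r d 1).
      rewrite zero_ext_pos by exact Hx0.
      assert (Hxx : 0 < x < 1) by lra.
      specialize (Hsm x ltac:(lra)).
      assert (Hv := inc_v_pos _ _ _ _ _ _ H x Hxx).
      assert (Hgv := velocity_growth _ _ _ _ _ _ _ H HC H1 Hxx).
      apply Rmult_lt_compat_l with (r := 2 * m) in Hsm; [|lra].
      replace (2 * m * (eps / (2 * m))) with (pos eps) in Hsm by (field; lra).
      apply Rabs_def1; unfold minus, plus, opp; simpl; lra.
Qed.

(** At the end point 1, r x <= x and r 1 = 1 make every difference quotient at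
    least 1. *)
Lemma increasing_lift_off : lifting_off_immediately r.
Proof.
  intros x Hx.
  assert (HD : D_in r (fun _ => F 1%nat x) (Ioc 0 1) x).
  { intros eps Heps. destruct (HFS 0%nat x Hx eps Heps) as [d [Hd Hlim]].
    exists d; split; [exact Hd|]; intros y Hy.
    rewrite <- !HF0; [apply Hlim, Hy|exact Hx|apply Hy]. }
  destruct Hx as [Hx0 Hx1].
  destruct Hx1 as [Hx1| ->].
  { split; [apply (inc_r_pos _ _ _ _ _ _ H); lra|].
    exists (F 1%nat x); split; [exact HD|apply (inc_v_pos _ _ _ _ _ _ H); lra]. }
  split; [lra|]. exists (F 1%nat 1); split; [exact HD|].
  destruct (exponent_gain_bounds C HC) as [Hg _].
  apply Rnot_le_lt; intro Hneg.
  destruct (HD 1 Rlt_0_1) as [d [Hd Hlim]].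
  set (x := Rmax (1 / 2) (1 - d / 2)).
  assert (B1 := Rmax_l (1 / 2) (1 - d / 2)). assert (B2 := Rmax_r (1 / 2) (1 - d / 2)).
  assert (B3 : x < 1) by (apply Rmax_lub_lt; lra).
  fold x in B1, B2.
  assert (Hq : Rabs ((r x - r 1) / (x - 1) - F 1%nat 1) < 1).
  { apply Hlim; split; [split; [split|]; lra|].
    simpl; unfold R_dist; apply Rabs_def1; lra. }
  apply Rabs_def2 in Hq. rewrite H1 in Hq.
  assert (Hgr := power_growth _ _ _ _ _ _ x H HC H1 ltac:(lra)).
  assert (Hp : Rpower x (exponent_gain C) < Rpower 1 (exponent_gain C))
    by (apply Rlt_Rpower_l; lra).
  unfold Rpower at 2 in Hp; rewrite ln_1, Rmult_0_r, exp_0 in Hp.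
  assert (Hrx : r x <= x) by nra.
  assert (Hq1 : 1 <= (r x - 1) / (x - 1)).
  { apply Rmult_le_reg_r with (1 - x); [lra|].
    replace ((r x - 1) / (x - 1) * (1 - x)) with (1 - r x) by (field; lra). lra. }
  lra.
Qed.

End Increasing.

End Jet.

Theorem lemma3p9 (M : nat) (hM : (2 <= M)%nat)
    (gamma s0 kappa : R) (rho1 rho : R -> R)
    (hrho : admissible_rho gamma s0 kappa rho1 rho)
    (r : R -> R)
    (hr_cont : continuous_on (Icc 0 1) r)
    (hr_smooth : smooth_on (Ioc 0 1) r)
    (hr_bvp : solves_bvp M rho r) :
  filterlim (jac M r) (at_right 0) (locally 0) /\
  (lifting_off_delayed r \/ lifting_off_immediately r) /\
  (lifting_off_delayed r -> smooth_on (Icc 0 1) r) /\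
  (lifting_off_immediately r ->
     C1_on (Icc 0 1) r /\ D_in r (fun _ => 0) (Icc 0 1) 0).
Proof.
  destruct hr_smooth as [F [HF0 HFS]].
  assert (Hm : 2 <= INR M) by (apply (le_INR 2 M), hM).
  assert (Hsigma : forall s, 0 <= Derive_n rho 2 s).
  { intro s; apply convex_second_derivative_nonneg.
    - apply (rho_smooth _ _ _ _ _ hrho).
    - apply (rho_convex _ _ _ _ _ hrho). }
  destruct (second_derivative_bound gamma s0 kappa rho1 rho (INR M)) as [C [HC HsC]];
    [lra|exact hrho|].
  assert (Hsol := bvp_radial_solution r F HF0 HFS M rho hr_cont hr_bvp).
  assert (H1 := bvp_1 _ _ _ hr_bvp).
  assert (Hinc : (forall x, 0 < x <= 1 -> 0 < r x) ->
            increasing_solution (INR M) C (Derive_n rho 2) r (F 1%nat) (F 2%nat)).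
  { intros Hpos; split; try assumption.
    - intros x Hx; apply Hpos; lra.
    - apply (velocity_positive (INR M) (Derive_n rho 2) r _ (F 2%nat));
        try assumption; [lra|].
      intros x Hx; apply Hpos; lra. }
  assert (Halt := delayed_or_positive (INR M) _ _ _ _ ltac:(lra) Hsigma Hsol H1).
  split; [|split; [|split]].
  - destruct Halt as [Hdel|Hpos].
    + apply (delayed_jac_limit r F HF0 HFS M Hdel).
    + apply (increasing_jac_limit r F HF0 HFS _ _ _ HC H1 (Hinc Hpos) M eq_refl).
  - destruct Halt as [Hdel|Hpos]; [left; exact Hdel|right].
    apply (increasing_lift_off r F HF0 HFS _ _ _ HC H1 (Hinc Hpos)).
  - apply (delayed_smooth r F HF0 HFS).
  - intros Himm.
    assert (Hi : increasing_solution (INR M) C (Derive_n rho 2) r (F 1%nat) (F 2%nat)).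
    { apply Hinc; intros x Hx; apply Himm, Hx. }
    split.
    + apply (increasing_C1 r F HF0 HFS _ _ _ HC H1 Hi).
    + apply (increasing_derivative_0 r F _ _ _ HC H1 Hi).
Qed.
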